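(* Let $0 \le d \le n$ be integers and let $P \subset \mathbb{R}^n$ be a convex lattice polytope with $\dim P = d$. Then the function $h^{\#}(P;z)$ is a polynomial in $z$ of the form \[ h^{\#}(P;z) = h^*(P;z), \] whose coefficients are nonnegative integers.
   Context: A convex lattice polytope in $\mathbb{R}^n$ is the convex hull of a nonempty finite subset of $\mathbb{Z}^n$. For an integer $t \ge 0$, $\mathcal E(P;t) := \#(tP \cap \mathbb{Z}^n)$; further $\mathrm{Ehr}(P;z) := \sum_{t=0}^\infty \mathcal E(P;t) z^t$ and $h^*(P;z) := (1-z)^{d+1}\mathrm{Ehr}(P;z)$. A horizontal giganture of $P$ is a polytope $G \subset \mathbb{R}^n$ such that $G = iP + a$ for some integer $i \ge 0$ and some $a \in \mathbb{Z}^n$ (for $i=0$ it is a single point). For an integer $t \ge 0$, $\mathcal H(P;t)$ is the number of horizontal gigantures of $P$ contained in $tP$. Put $\mathrm{SE}(P;z) := \sum_{t=0}^\infty \mathcal H(P;t) z^t$ and $h^{\#}(P;z) := (1-z)^{d+2}\,\mathrm{SE}(P;z)$.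
   Formalization: The equality of h^# with h^* is asserted for d ≥ 1; for d = 0 (P a point) it fails, since H(P;t) = 1 gives h^# = 1 − z while h^* = 1, so there it is proved only with gigantures iP + a counted together with their scale i, 0 ≤ i ≤ t. *)

(* Defs.v *)
From HB Require Import structures.
From mathcomp Require Import all_boot all_order all_algebra finmap.
From mathcomp Require Import all_classical all_reals convex.

Set Implicit Arguments.
Unset Strict Implicit.
Unset Printing Implicit Defensive.
Import Order.TTheory GRing.Theory Num.Theory.
Local Open Scope classical_set_scope.
Local Open Scope ring_scope.

Section Polytopes.
Context (R : realType) (n : nat).
Implicit Types (P A G V : set 'rV[R]_n).

Definition lattice : set 'rV[R]_n := [set x | x \is a mxOver Num.int].

Definition convex_hull V : set 'rV[R]_n :=
  smallest (fun A => convex_set (A : set (convex_lmodType 'rV[R]_n))) V.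

Definition lattice_polytope P :=
  exists V, [/\ finite_set V, V !=set0, V `<=` lattice & P = convex_hull V].

Definition affine_subspace (d : nat) A :=
  exists (a : 'rV[R]_n) (U : {vspace 'rV[R]_n}),
    \dim U = d /\ A = [set a + u | u in [set` U]].

Definition affine_hull P : set 'rV[R]_n :=
  smallest (fun A => exists k, affine_subspace k A) P.

Definition has_dim P (d : nat) := affine_subspace d (affine_hull P).

(* i P + a *)
Definition dilate (i : nat) (a : 'rV[R]_n) P : set 'rV[R]_n :=
  [set i%:R *: x + a | x in P].

(* The cardinality of a finite set; every set counted below is finite when P
   is a polytope (on infinite sets, fset_set gives the empty set). *)
Definition card_set (T : choiceType) (A : set T) : nat := #|` fset_set A|.

Definition ehrhart P (t : nat) : nat := card_set (dilate t 0 P `&` lattice).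

Definition horizontal_giganture P G :=
  exists (i : nat) (a : 'rV[R]_n), lattice a /\ G = dilate i a P.

(* Gigantures are counted as subsets of R^n, without multiplicity. *)
Definition giganture_count P (t : nat) : nat :=
  card_set [set G | horizontal_giganture P G /\ G `<=` dilate t 0 P].

(* Gigantures i P + a counted together with their scale i. When dim P > 0,
   the set i P + a determines (i, a), and its inclusion in t P forces i <= t,
   so this agrees with giganture_count. When P is a point, i P + a does not
   determine i, and the bound i <= t is what keeps the count finite. *)
Definition scaled_giganture_count P (t : nat) : nat :=
  card_set [set ia : nat * 'rV[R]_n |
    [/\ lattice ia.2, (ia.1 <= t)%N & dilate ia.1 ia.2 P `<=` dilate t 0 P]].

(* The coefficients of (1 - z)^m * \sum_t u t z^t, as a formal power series. *)
Definition numerator (m : nat) (u : nat -> nat) (k : nat) : int :=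
  \sum_(j < k.+1) ((1 - 'X : {poly int}) ^+ m)`_j * (u (k - j)%N)%:Z.

Definition hstar (d : nat) P : nat -> int := numerator d.+1 (ehrhart P).

Definition hsharp (d : nat) P : nat -> int := numerator d.+2 (giganture_count P).

Definition scaled_hsharp (d : nat) P : nat -> int :=
  numerator d.+2 (scaled_giganture_count P).

End Polytopes.

(* Main.v *)
Require Import Defs.
From HB Require Import structures.
From mathcomp Require Import all_boot all_order all_algebra finmap.
From mathcomp Require Import all_classical all_reals convex.
From mathcomp Require Import interval_inference zify ring lra.
Set Implicit Arguments.
Unset Strict Implicit.
Unset Printing Implicit Defensive.
Import Order.TTheory GRing.Theory Num.Theory.
Local Open Scope classical_set_scope.
Local Open Scope ring_scope.

(* Place P at height 1 and consider the cone over it. Generic heights c on the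
   vertices induce a triangulation, and pushing each point in a generic
   direction w of the cone assigns it to exactly one simplicial cell: this is
   linear programming with a primal and a dual perturbation. A half-open
   simplicial cone spanned by d+1 lattice points at height 1 is tiled by
   translates of its fundamental parallelepiped, so multiplying its generating
   function by (1 - z)^(d+1) counts the lattice points of the parallelepiped
   by height; summing over the cells gives h^*.
   For gigantures, i P + a is contained in t P exactly when a lies in
   (t - i) P, hence SE = Ehr / (1 - z). *)

(** * Vectors in general position and small perturbations *)

Section Generic.
Context (R : realFieldType).

(** The numbers [1], ..., [size p] are more numerous than the roots of [p]. *)
Lemma nonroot_pos (p : {poly R}) : p != 0 -> exists2 x, 0 < x & ~~ root p x.
Proof.
move=> p0; pose s := [seq k.+1%:R : R | k <- iota 0 (size p)].
have us : uniq s.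
  rewrite map_inj_uniq ?iota_uniq// => a b /eqP.
  by rewrite eqr_nat eqSS => /eqP.
have : ~~ all (root p) s.
  by apply/negP => /max_poly_roots/(_ us); rewrite size_map size_iota ltnn => /(_ p0).
by case/allPn => x /mapP[k _ ->] rx; exists k.+1%:R => //; rewrite ltr0n.
Qed.

(* A vector on the moment curve: each condition excludes the roots of one
   nonzero polynomial. *)
Lemma generic_vector N (I : finType) (D : pred I) (F : I -> 'cV[R]_N) :
    (forall i, D i -> F i != 0) ->
  exists x : 'rV[R]_N,
    (forall k, 0 < x 0 k) /\ (forall i, D i -> (x *m F i) 0 0 != 0).
Proof.
move=> F0; pose q i := rVpoly (F i)^T.
have [|x x0 rx] := @nonroot_pos (\prod_(i | D i) q i).
  apply/prodf_neq0 => i Di; apply: contra (F0 i Di) => /eqP qi0.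
  by rewrite -[F i]trmxK -[(F i)^T]rVpolyK -/(q i) qi0 linear0 trmx0.
exists (\row_k x ^+ k); split=> [k|i Di]; first by rewrite mxE exprn_gt0.
have : ~~ root (q i) x.
  apply: contra rx => /rootP rx; apply/rootP.
  by rewrite horner_prod (bigD1 i)//= rx mul0r.
apply: contra => /eqP e; apply/rootP; rewrite -[RHS]e horner_poly mxE.
by apply: eq_bigr => k _; rewrite !mxE valK mulrC mxE.
Qed.

(** Adding [e * d i] then cannot change the sign of a nonzero [x i]. Every ratio [|d i| / |x i|] is
    at most the sum [S], in which the terms with [x i = 0] vanish by the convention on inverses. *)
Lemma small_step (I : finType) (x d : I -> R) :
  exists2 e, 0 < e & forall i, x i != 0 -> e * `|d i| < `|x i|.
Proof.
pose S := \sum_i `|d i| / `|x i|.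
have S0 : 0 <= S by apply: sumr_ge0 => i _; rewrite divr_ge0.
have S1 : 0 < 1 + S by rewrite ltr_wpDr.
exists (1 + S)^-1 => [|i xi]; first by rewrite invr_gt0.
rewrite mulrC ltr_pdivrMr// mulrC -ltr_pdivrMr ?normr_gt0//.
apply: (@le_lt_trans _ _ S); last by rewrite ltrDr.
by rewrite /S (bigD1 i)//= lerDl sumr_ge0// => j _; rewrite divr_ge0.
Qed.

End Generic.

(** * Row bases of a matrix and coordinates in them *)

Section Bases.
Context (R : realFieldType) (N m : nat) (A : 'M[R]_(N, m)).
Implicit Types (B S : {set 'I_N}) (x : 'rV[R]_N) (y : 'rV[R]_m).

Definition selmx B : 'M[R]_(#|B|, N) := rowsub (@enum_val _ (mem B)) 1%:M.

Definition is_basis B :=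
  row_free (selmx B *m A) && (A <= selmx B *m A)%MS.

(** Coordinates in the basis [B] are stored as vectors over all of ['I_N], zero off [B], so that
    different bases share one cost vector. *)
Definition coordmx B : 'M[R]_(m, N) := pinvmx (selmx B *m A) *m selmx B.

Definition supported x B := forall i, i \notin B -> x 0 i = 0.

Lemma selmx_out k B (z : 'M[R]_(k, #|B|)) j i :
  i \notin B -> (z *m selmx B) j i = 0.
Proof.
move=> iB; rewrite mxE big1// => l _; rewrite [selmx B l i]mxE mxE.
case: (eqVneq (enum_val l) i) => [e|_]; last by rewrite mulr0.
by rewrite -e enum_valP in iB.
Qed.

Lemma selmxK B : selmx B *m (selmx B)^T = 1%:M.
Proof.
apply/matrixP => i j; rewrite !mxE (bigD1 (enum_val i))//= big1 => [|k /negPf ki].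
  by rewrite !mxE eqxx mul1r addr0 (inj_eq enum_val_inj) eq_sym.
by rewrite !mxE eq_sym ki mul0r.
Qed.

Lemma supported_selmx x B : supported x B -> x = x *m (selmx B)^T *m selmx B.
Proof.
move=> xB; apply/rowP => i; have [iB|iB] := boolP (i \in B); last first.
  by rewrite selmx_out// xB.
have ei : enum_val (enum_rank_in iB i) = i by rewrite enum_rankK_in.
rewrite mxE (bigD1 (enum_rank_in iB i))//= big1 => [|k ki].
  rewrite !mxE ei eqxx mulr1 addr0 (bigD1 i)//= big1 => [|l /negPf li].
    by rewrite !mxE ei eqxx mulr1 addr0.
  by rewrite !mxE ei eq_sym li mulr0.
rewrite [selmx B k i]mxE [1%:M _ _]mxE mxE; case: (eqVneq (enum_val k) i) => [e|_]; last by rewrite mulr0.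
by case/eqP: ki; apply: enum_val_inj; rewrite e ei.
Qed.

Lemma row_free_selP B :
  row_free (selmx B *m A) <->
  (forall x, supported x B -> x *m A = 0 -> x = 0).
Proof.
split=> [fB x xB xA|h].
  have := xA; rewrite (supported_selmx xB) -mulmxA => /eqP.
  by rewrite mulmx_free_eq0// => /eqP ->; rewrite mul0mx.
apply: inj_row_free => v; rewrite mulmxA => /h vS.
rewrite -[v]mulmx1 -selmxK mulmxA vS ?mul0mx// => i iB.
exact: selmx_out.
Qed.

Lemma coordmx_supp B y : supported (y *m coordmx B) B.
Proof. by move=> i iB; rewrite mulmxA selmx_out. Qed.

Lemma coordmx_out B i j : j \notin B -> coordmx B i j = 0.
Proof. by move=> jB; rewrite selmx_out. Qed.

Lemma coordmxK B k (y : 'M_(k, m)) :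
  is_basis B -> (y <= A)%MS -> y *m coordmx B *m A = y.
Proof.
case/andP=> _ AB yA; rewrite mulmxA -(mulmxA _ _ A) mulmxKpV//.
exact: submx_trans AB.
Qed.

Lemma supported_coord B x : is_basis B -> supported x B ->
  x *m A *m coordmx B = x.
Proof.
case/andP=> fB _ xB.
by rewrite {1}(supported_selmx xB) -(mulmxA _ _ A) /coordmx (mulmxA _ (pinvmx _)) mulmxKp// -supported_selmx.
Qed.

Lemma coord_row B i : is_basis B -> i \in B ->
  row i A *m coordmx B = delta_mx 0 i.
Proof.
move=> bB iB; rewrite rowE supported_coord// => j jB.
by rewrite mxE eqxx; case: eqP => // e; rewrite e iB in jB.
Qed.

Lemma basis_card B : is_basis B -> #|B| = \rank A.
Proof.
case/andP=> fB AB; apply/eqP; rewrite eqn_leq.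
rewrite -{1}(eqP fB) mxrankS ?submxMl//=.
by rewrite (leq_trans (mxrankS AB))// rank_leq_row.
Qed.

(** A maximal independent set of rows containing [S] spans, since adding any other row creates a
    dependency. *)
Lemma extend_basis S : row_free (selmx S *m A) ->
  exists2 B, is_basis B & S \subset B.
Proof.
pose P B := row_free (selmx B *m A).
move=> fS; have [B /maxsetP[fB maxB] SB] := @maxset_exists _ P _ fS.
exists B => //; rewrite /is_basis [row_free _]fB /=.
have suppB x : supported x B -> (x *m A <= selmx B *m A)%MS.
  by move=> /supported_selmx ->; rewrite -mulmxA submxMl.
apply/row_subP => i; rewrite rowE; have [iB|iB] := boolP (i \in B).
  apply: suppB => j jB; rewrite mxE eqxx; case: eqP => // e.
  by rewrite e iB in jB.
have : ~~ P (i |: B).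
  apply/negP => /maxB/(_ (subsetU1 _ _)) e.
  by rewrite -e setU11 in iB.
rewrite /P -kermx_eq0 => /rowV0Pn[v /sub_kermxP vA v0].
pose x := v *m selmx (i |: B).
have xA : x *m A = 0 by rewrite -mulmxA.
have x0 : x != 0.
  apply: contra v0 => /eqP x0.
  by rewrite -[v]mulmx1 -selmxK mulmxA -/x x0 mul0mx.
have xs j : j != i -> j \notin B -> x 0 j = 0.
  by move=> ji jB; rewrite /x selmx_out// !inE negb_or ji.
move: x xA x0 xs => x xA x0 xs.
(* A dependency avoiding row [i] would be one among the rows of [B]; hence its coefficient at [i] is
   nonzero and row [i] can be solved for. *)
have [xi|xi] := eqVneq (x 0 i) 0.
  have [/(_ fB x)] := row_free_selP B => h.
  case/eqP: x0; apply: h => // j jB.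
  by have [->//|ji] := eqVneq j i; apply: xs.
have -> : delta_mx 0 i = (x 0 i)^-1 *: x - ((x 0 i)^-1 *: x - delta_mx 0 i).
  by rewrite opprB addrC subrK.
rewrite mulmxBl -scalemxAl xA scaler0 sub0r eqmx_opp.
apply: suppB => j jB; rewrite !mxE eqxx /=.
have [->|ji] := eqVneq j i; first by rewrite mulVf// subrr.
by rewrite (xs j)// mulr0 subr0.
Qed.

End Bases.

(** * Linear programming and the triangulation induced by generic heights *)

Section Subdivision.
Context (R : realFieldType) (N m : nat) (A : 'M[R]_(N, m)).
Context (h : 'cV[R]_m) (Ah : A *m h = const_mx 1).
Implicit Types (B S : {set 'I_N}) (x : 'rV[R]_N) (y : 'rV[R]_m).

Local Notation K := (coordmx A).

Lemma sum_height x : \sum_i x 0 i = (x *m A *m h) 0 0.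
Proof.
by rewrite -mulmxA Ah mxE; apply: eq_bigr => i _; rewrite mxE mulr1.
Qed.

(* Moving along a linear dependency until a coordinate vanishes; the direction
   is chosen so that the cost does not increase. *)
Lemma caratheodory (c : 'cV[R]_N) x : (forall i, 0 <= x 0 i) ->
  exists B, [/\ is_basis A B, forall i, 0 <= (x *m A *m K B) 0 i
    & (x *m A *m K B *m c) 0 0 <= (x *m c) 0 0].
Proof.
pose supp x := [set i | x 0 i != 0]%SET.
have [k] := ubnP #|supp x|; elim: k x => // k IH x sk x0.
have xs : supported x (supp x) by move=> i; rewrite inE negbK => /eqP.
have [fs|nfs] := boolP (row_free (selmx R (supp x) *m A)).
  have [B bB sB] := extend_basis fs.
  have xB : supported x B by move=> i iB; apply: xs; apply: contra iB; apply: (fintype.subsetP sB).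
  by exists B; rewrite supported_coord.
have [d [ds dA d0 dc]] : exists d, [/\ supported d (supp x), d *m A = 0,
    d != 0 & (d *m c) 0 0 <= 0].
  move: nfs; rewrite -kermx_eq0 => /rowV0Pn[v /sub_kermxP vA v0].
  pose d := v *m selmx R (supp x).
  have ds : supported d (supp x) by move=> i iB; apply: selmx_out.
  have dA : d *m A = 0 by rewrite -mulmxA.
  have d0 : d != 0.
    by apply: contra v0 => /eqP d0; rewrite -[v]mulmx1 -(selmxK R (supp x)) mulmxA -/d d0 mul0mx.
  have [dc|dc] := leP ((d *m c) 0 0) 0; first by exists d.
  exists (- d); split; rewrite ?oppr_eq0 ?mulNmx ?dA ?oppr0//.
    by move=> i /ds di; rewrite mxE di oppr0.
  by rewrite mxE oppr_le0 ltW.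
(* All rows have height one, so the entries of a dependency sum to zero, and a nonzero one has a
   negative entry. *)
have [j dj] : exists j, d 0 j < 0.
  apply/existsP; apply: contraT; rewrite negb_exists => /forallP dp.
  case/eqP: d0; apply/rowP => i; rewrite [RHS]mxE.
  have dp' l : true -> 0 <= d 0 l by rewrite leNgt.
  apply: (psumr_eq0P dp') => //.
  by rewrite (sum_height d) dA mul0mx mxE.
(* Ratio test: the smallest [F l] is the largest step that keeps all coordinates nonnegative, and it
   makes coordinate [l] vanish. *)
pose F i := x 0 i / - d 0 i.
have [l dl lmin] := arg_minP F (i0 := j) (P := fun i => d 0 i < 0) dj.
pose t := F l.
have t0 : 0 <= t by rewrite divr_ge0// oppr_ge0 ltW.
pose x' := x + t *: d.
have x'E i : x' 0 i = x 0 i + t * d 0 i by rewrite !mxE.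
have x'A : x' *m A = x *m A by rewrite mulmxDl -scalemxAl dA scaler0 addr0.
have x'0 i : 0 <= x' 0 i.
  rewrite x'E; have [di|di] := leP 0 (d 0 i); first by rewrite addr_ge0// mulr_ge0.
  have := lmin i di; rewrite -/t ler_pdivlMr ?oppr_gt0// mulrN.
  by rewrite -subr_ge0 opprK.
have x'l : x' 0 l = 0.
  rewrite x'E /t /F invrN mulrN mulNr divfK ?subrr//.
  by rewrite lt_eqF.
have sx' : (#|supp x'| < k)%N.
  rewrite ltnS in sk; apply: leq_trans sk; apply: proper_card; apply/properP; split.
    apply/fintype.subsetP => i; rewrite inE => x'i; apply: contraT => ix.
    by rewrite x'E xs// ds// mulr0 addr0 eqxx in x'i.
  exists l; last by rewrite inE x'l eqxx.
  by apply: contraT => /ds dl0; rewrite dl0 ltxx in dl.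
have [B [bB Bp Bc]] := IH x' sx' x'0.
exists B; rewrite -x'A; split=> //; apply: (le_trans Bc).
by rewrite mulmxDl -scalemxAl mxE [X in _ + X]mxE gerDl mulr_ge0_le0.
Qed.

Context (mu : 'rV[R]_N) (mu0 : forall i, 0 < mu 0 i).
Context (c : 'cV[R]_N).
Let w := mu *m A.
(** Primal and dual genericity: [w] lies in no span of a basis with one vector removed, and no row
    outside a basis, lifted to its height in [c], lies in the span of the lifted basis. *)
Context (gen_w : forall B b, is_basis A B -> b \in B -> (w *m K B) 0 b != 0).
Context (gen_c : forall B i, is_basis A B -> i \notin B ->
  (A *m K B *m c) i 0 != c i 0).

(* Dual feasibility: the cells of the triangulation induced by the heights c. *)
Definition optimal B :=
  is_basis A B && [forall i in ~: B, (A *m K B *m c) i 0 < c i 0].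

(* The points y such that y + e w lies in the interior of the cone over B for
   all small e > 0. *)
Definition halfopen B y :=
  [forall b in B, (0 <= (y *m K B) 0 b) &&
                  (((w *m K B) 0 b < 0) ==> (0 < (y *m K B) 0 b))].

(** Weak duality with its equality case: the two costs differ by the sum, over [i] outside [B], of
    [x 0 i] times a positive reduced cost. *)
Lemma optimal_le B x : optimal B -> (forall i, 0 <= x 0 i) ->
  (x *m A *m K B *m c) 0 0 <= (x *m c) 0 0 ?= iff [forall i in ~: B, x 0 i == 0].
Proof.
case/andP=> bB /forall_inP oB x0.
have E : (x *m c) 0 0 - (x *m A *m K B *m c) 0 0 =
    \sum_(i in ~: B) x 0 i * (c i 0 - (A *m K B *m c) i 0).
  rewrite -(mulmxA x A (K B)) -(mulmxA x (A *m K B) c).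
  move eG : (A *m K B *m c) => G; rewrite mxE [in X in _ - X]mxE -sumrB.
  rewrite [LHS](bigID (mem (~: B)))/= [X in _ + X]big1 ?addr0 => [|i].
    by apply: eq_bigr => i _; rewrite mulrBr.
  rewrite inE negbK => iB; rewrite -mulrBr -eG.
  suff -> : (A *m K B *m c) i 0 = c i 0 by rewrite subrr mulr0.
  have -> : (A *m K B *m c) i 0 = (row i A *m K B *m c) 0 0.
    by rewrite -!row_mul [RHS]mxE.
  by rewrite coord_row// -rowE mxE.
have ge0 i : i \in ~: B -> 0 <= x 0 i * (c i 0 - (A *m K B *m c) i 0).
  by move=> iB; rewrite mulr_ge0// subr_ge0 ltW// oB.
split; first by rewrite -subr_ge0 E sumr_ge0.
rewrite eq_sym -subr_eq0 E psumr_eq0//.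
apply/allP/forall_inP => [H i iB|H i _]; last first.
  by apply/implyP => /H/eqP ->; rewrite mul0r.
have := H i (mem_index_enum i); rewrite iB mulf_eq0 => /orP[]//.
by rewrite subr_eq0 gt_eqF// oB.
Qed.

(** For small [e], a coordinate of [y + e *: w] has the sign of that of [y], or that of [w] where
    [y] vanishes; one [e] serves the finitely many bases. By [gen_w] the second sign is never
    zero. *)
Lemma perturb y : exists e, [/\ 0 < e,
  forall B b, is_basis A B -> b \in B -> ((y + e *: w) *m K B) 0 b != 0 &
  forall B, is_basis A B ->
    (halfopen B y <-> forall b, b \in B -> 0 < ((y + e *: w) *m K B) 0 b)].
Proof.
have [e e0 eP] := small_step
  (fun p : {set 'I_N} * 'I_N => (y *m K p.1) 0 p.2) (fun p => (w *m K p.1) 0 p.2).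
have key B b : is_basis A B -> b \in B ->
    (0 < ((y + e *: w) *m K B) 0 b) = (0 <= (y *m K B) 0 b) &&
                  (((w *m K B) 0 b < 0) ==> (0 < (y *m K B) 0 b))
    /\ ((y + e *: w) *m K B) 0 b != 0.
  move=> bB Bb; have := eP (B, b); have := gen_w bB Bb.
  have -> : ((y + e *: w) *m K B) 0 b = (y *m K B) 0 b + e * (w *m K B) 0 b.
    by rewrite mulmxDl -scalemxAl mxE [in X in _ + X]mxE.
  rewrite /=; move: ((y *m K B) 0 b) ((w *m K B) 0 b) => u v v0.
  have [->|u0 /(_ isT)] := eqVneq u 0.
    move=> _; rewrite add0r pmulr_rgt0// lexx ltxx /= implybF -leNgt.
    by rewrite lt_neqAle eq_sym v0 mulf_neq0// gt_eqF.
  have -> : e * `|v| = `|e * v| by rewrite normrM (gtr0_norm e0).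
  rewrite ltr_norml => /andP[]; have [u1|u1|u1] := ltgtP u 0.
  - by rewrite ltr0_norm// => p q; split; [|apply/eqP => E]; lra.
  - rewrite gtr0_norm// => p q /=; rewrite implybT.
    by split; [|apply/eqP => E]; lra.
  - by rewrite u1 eqxx in u0.
exists e; split=> // [B b bB Bb|B bB]; first by case: (key B b bB Bb).
split=> [/forall_inP H b' Bb'|H]; first by have [-> _] := key B b' bB Bb'; apply: H.
by apply/forall_inP => b' Bb'; have [<- _] := key B b' bB Bb'; apply: H.
Qed.

(** Among the bases in which the perturbed point has nonnegative coordinates, one of least cost is
    optimal: otherwise a simplex pivot would lower the cost. *)
Lemma halfopen_exists x : (forall i, 0 <= x 0 i) ->
  exists2 B, optimal B & halfopen B (x *m A).
Proof.
move=> x0; have [e [e0 ne0 eP]] := perturb (x *m A).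
set y := x *m A + e *: w in ne0 eP.
have yE : (x + e *: mu) *m A = y by rewrite mulmxDl -scalemxAl.
have xe0 i : 0 <= (x + e *: mu) 0 i.
  by rewrite !mxE addr_ge0// mulr_ge0// ltW.
have [B0 [bB0 pB0 _]] := caratheodory c xe0; rewrite yE in pB0.
pose P B := is_basis A B && [forall i, 0 <= (y *m K B) 0 i].
have PB0 : P B0 by rewrite /P bB0; apply/forallP.
pose cost B := (y *m K B *m c) 0 0.
have [B /andP[bB /forallP pB] minB] := arg_minP cost PB0.
(* Genericity turns nonnegative coordinates into positive ones, which leaves room for the pivot step
   below. *)
have yB b : b \in B -> 0 < (y *m K B) 0 b by move=> Bb; rewrite lt_neqAle eq_sym ne0/=.
exists B; last by apply/eP.
rewrite /optimal bB; apply/forall_inP => i; rewrite inE => iB.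
rewrite lt_neqAle gen_c//= leNgt; apply/negP => ci.
pose z := y *m K B.
have yA : (y <= A)%MS by rewrite -yE submxMl.
have zA : z *m A = y by rewrite coordmxK.
(* Pivot direction: bring in row [i] and compensate inside [B]. Its cost is the reduced cost of [i],
   assumed negative. *)
pose d := delta_mx 0 i - row i A *m K B.
have dA : d *m A = 0.
  by rewrite mulmxBl -rowE coordmxK ?subrr ?row_sub.
have dc : (d *m c) 0 0 < 0.
  rewrite mulmxBl -rowE -!row_mul mxE [X in _ + X]mxE.
  by rewrite [X in X + _]mxE [X in _ - X]mxE subr_lt0.
have [t t0 tP] := small_step (fun i => z 0 i) (fun i => d 0 i).
have zd0 j : 0 <= (z + t *: d) 0 j.
  have -> : (z + t *: d) 0 j = z 0 j + t * d 0 j by rewrite !mxE.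
  have [Bj|Bj] := boolP (j \in B).
    have zj := yB _ Bj; have := tP j; rewrite gt_eqF// => /(_ isT).
    have -> : t * `|d 0 j| = `|t * d 0 j| by rewrite normrM (gtr0_norm t0).
    rewrite (gtr0_norm zj).
    by rewrite ltr_norml => /andP[]; lra.
  rewrite /z coordmx_supp// add0r mulr_ge0 ?(ltW t0)// mxE [X in _ + X]mxE coordmx_supp//.
  by rewrite oppr0 addr0 mxE ler0n.
have [B' [bB' pB' cB']] := caratheodory c zd0.
have zdA : (z + t *: d) *m A = y by rewrite mulmxDl -scalemxAl dA scaler0 addr0.
rewrite zdA in pB' cB'.
have PB' : P B' by rewrite /P bB'; apply/forallP.
have := le_trans (minB _ PB') cB'; rewrite /cost -/z leNgt => /negP; apply.
by rewrite mulmxDl -scalemxAl mxE [X in _ + X]mxE gtrDl pmulr_rlt0.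
Qed.

(** The perturbed point has the same cost in both cells, so the equality case of [optimal_le] makes
    its [B']-coordinates vanish outside [B]. They are positive on [B'], hence [B'] lies in [B], and
    symmetrically. *)
Lemma halfopen_unique B B' y : (y <= A)%MS -> optimal B -> optimal B' ->
  halfopen B y -> halfopen B' y -> B = B'.
Proof.
move=> yA oB oB'; have [e [e0 _ eP]] := perturb y.
set u := y + e *: w in eP.
have uA : (u <= A)%MS by rewrite addmx_sub ?scalemx_sub// submxMl.
have bas C : optimal C -> is_basis A C by case/andP.
have pos C : optimal C -> halfopen C y -> forall i, 0 <= (u *m K C) 0 i.
  move=> oC /eP-/(_ (bas _ oC)) H i.
  have [/H/ltW//|iC] := boolP (i \in C); by rewrite coordmx_supp.
have le C C' : optimal C -> optimal C' -> halfopen C' y ->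
    (u *m K C *m c) 0 0 <= (u *m K C' *m c) 0 0
      ?= iff [forall i in ~: C, (u *m K C') 0 i == 0].
  move=> oC oC' hC'.
  have := optimal_le oC (pos _ oC' hC').
  by rewrite coordmxK// bas.
have sub C C' : optimal C -> optimal C' -> halfopen C y -> halfopen C' y -> C' \subset C.
  move=> oC oC' hC hC'.
  have [l1 /esym E] := le C C' oC oC' hC'; have [l2 _] := le C' C oC' oC hC.
  move: E; rewrite eq_le l1 l2 => /forall_inP E.
  apply/fintype.subsetP => i iC'; apply: contraT => iC.
  have := E i; rewrite inE => /(_ iC).
  by have [/(_ hC')/(_ i iC')/gt_eqF ->] := eP C' (bas _ oC').
by move=> hB hB'; apply/eqP; rewrite finset.eqEsubset !sub.
Qed.

End Subdivision.

(** * Multiplication of power series by powers of [1 - z] *)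

Section Numerator.
Implicit Types (u v : nat -> nat).

Lemma numerator0 u k : numerator 0 u k = u k.
Proof.
rewrite /numerator big_ord_recl big1 => [|i _].
  by rewrite expr0 coef1 mul1r addr0 subn0.
by rewrite expr0 coef1 mul0r.
Qed.

(** The recurrence says that the series of [u] is that of [v] divided by [1 - z]. *)
Lemma numeratorS m u v k :
  (forall t, u t = (v t + (if t is t'.+1 then u t' else 0))%N) ->
  numerator m.+1 u k = numerator m v k.
Proof.
move=> uE; pose U := \poly_(i < k.+1) (u i)%:Z.
have -> : numerator m.+1 u k = ((1 - 'X) ^+ m.+1 * U)`_k.
  rewrite coefM; apply: eq_bigr => j _.
  by rewrite coef_poly ltnS leq_subr.
rewrite exprSr -mulrA coefM; apply: eq_bigr => j _; congr (_ * _).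
rewrite mulrBl mul1r coefB coefXM !coef_poly ltnS leq_subr uE PoszD.
case E : (k - j)%N => [|l] /=; first by rewrite addr0 subr0.
by rewrite ltnS (leq_trans (leqnSn _))// -?E ?leq_subr// addrK.
Qed.

Lemma numerator_sum m (I : Type) (r : seq I) (u : I -> nat -> nat) k :
  numerator m (fun t => \sum_(i <- r) u i t)%N k =
  \sum_(i <- r) numerator m (u i) k.
Proof.
rewrite /numerator exchange_big; apply: eq_bigr => j _.
by rewrite -mulr_sumr (big_morph Posz PoszD erefl).
Qed.

Lemma eq_numerator m u v k : u =1 v -> numerator m u k = numerator m v k.
Proof. by move=> uv; apply: eq_bigr => j _; rewrite uv. Qed.

End Numerator.

(** * Cardinalities of finite sets *)

Section CardSet.

Lemma card_set0 (T : choiceType) : card_set (set0 : set T) = 0%N.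
Proof. by rewrite /card_set fset_set0 cardfs0. Qed.

Lemma card_setU_disjoint (T : choiceType) (A B : set T) :
  finite_set A -> finite_set B -> A `&` B = set0 ->
  card_set (A `|` B) = (card_set A + card_set B)%N.
Proof.
move=> fA fB AB; rewrite /card_set fset_setU// cardfsU -fset_setI// AB.
by rewrite fset_set0 cardfs0 subn0.
Qed.

Lemma card_set_image (T U : choiceType) (f : T -> U) (A : set T) :
  finite_set A -> (forall x y, A x -> A y -> f x = f y -> x = y) ->
  card_set (f @` A) = card_set A.
Proof.
move=> fA fI; rewrite /card_set fset_set_image// card_in_imfset//= => x y.
by rewrite !in_fset_set// !inE; exact: fI.
Qed.

Lemma card_set_partition (T : choiceType) (I : eqType) (s : seq I)
    (F : I -> set T) : uniq s ->
  (forall i, i \in s -> finite_set (F i)) ->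
  (forall i j x, i \in s -> j \in s -> F i x -> F j x -> i = j) ->
  card_set [set x | exists2 i, i \in s & F i x] =
  (\sum_(i <- s) card_set (F i))%N.
Proof.
elim: s => [_ _ _|a s IH /= /andP[as_ us] fF dF].
  by rewrite big_nil -(card_set0 T); congr card_set; apply/seteqP; split=> x // [].
have fs i : i \in s -> finite_set (F i) by move=> si; apply: fF; rewrite inE si orbT.
have -> : [set x | exists2 i, i \in a :: s & F i x] =
    F a `|` [set x | exists2 i, i \in s & F i x].
  apply/seteqP; split=> x /=.
    by case=> i; rewrite inE => /predU1P[-> ?|si Fi]; [left|right; exists i].
  case=> [Fa|[i si Fi]]; first by exists a; rewrite ?mem_head.
  by exists i => //; rewrite inE si orbT.
rewrite big_cons card_setU_disjoint ?IH//.
- by move=> i j x si sj; apply: dF; rewrite inE ?si ?sj orbT.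
- by apply: fF; rewrite mem_head.
- have -> : [set x | exists2 i, i \in s & F i x] = \bigcup_(i in [set` s]) F i.
    by apply/seteqP; split=> x [i] /=; exists i.
  by apply: bigcup_finite => //; exact: finite_seq.
apply/seteqP; split=> x // [Fa [i si Fi]].
have ai : a = i by apply: dF Fa Fi => //; rewrite inE ?eqxx// si orbT.
by rewrite ai si in as_.
Qed.

End CardSet.

(** * Finiteness of the lattice points in a box *)

Section Lattice.
Context (R : realType) (n : nat).
Implicit Types (x : 'rV[R]_n).

Lemma finite_lattice_box (M : R) :
  finite_set [set x | @lattice R n x /\ forall k, `|x 0 k| <= M].
Proof.
pose K := Num.bound M.
have MK (k : 'I_n) x : `|x 0 k| <= M -> `|x 0 k| < K%:R.
  move=> xM; have M0 : 0 <= M by apply: le_trans xM.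
  by apply: (le_lt_trans xM); apply: archi_boundP.
pose f (g : 'rV['I_(K + K)]_n) : 'rV[R]_n := \row_k ((g 0 k)%:R - K%:R).
apply: (@sub_finite_set _ _ (f @` setT)); last exact/finite_image/finite_finset.
move=> x [/mxOverP xL xM] /=.
have h k : exists i : 'I_(K + K), x 0 k = i%:R - K%:R.
  have /intrP[z zE] := xL 0 k; have := MK k x (xM k).
  rewrite zE -[K%:R]/((Posz K)%:~R) ltr_norml -rmorphN /= !ltr_int => /andP[z1 z2].
  have zK : 0 <= z + K by lia.
  have zl : (`|(z + K)%R|%N < K + K)%N by lia.
  exists (Ordinal zl); apply/eqP; rewrite eq_sym subr_eq.
  have -> : (Ordinal zl)%:R = (Posz `|(z + K)%R|%N)%:~R :> R by [].
  by rewrite gez0_abs// intrD.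
have [g gE] := choice h.
by exists (\row_k g k) => //; apply/rowP => k; rewrite !mxE -gE.
Qed.

End Lattice.

(** * Half-open simplicial cones and their fundamental parallelepipeds *)

Section Cells.
Context (R : realType) (N n : nat) (V : 'M[R]_(N, n)).
Context (VL : forall i j, V i j \is a Num.int).
Implicit Types (x : 'rV[R]_n) (B S : {set 'I_N}) (z : 'rV[R]_N).

Definition homog : 'M[R]_(N, n + 1) := row_mx V (const_mx 1).
Definition homog_point x (t : nat) : 'rV[R]_(n + 1) := row_mx x (const_mx t%:R).

Definition height : 'cV[R]_(n + 1) := col_mx 0 (const_mx 1).

Local Notation A := homog.

Lemma homog_height : A *m height = const_mx 1.
Proof.
rewrite mul_row_col mulmx0 add0r; apply/matrixP => i j.
by rewrite !mxE big_ord1 !mxE mulr1.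
Qed.

Lemma homog_point_height x t : (homog_point x t *m height) 0 0 = t%:R.
Proof. by rewrite mul_row_col mulmx0 add0r mxE big_ord1 !mxE mulr1. Qed.

Lemma mul_homog z : z *m A = row_mx (z *m V) (const_mx (\sum_i z 0 i)).
Proof.
rewrite mul_mx_row; congr row_mx; apply/matrixP => i j; rewrite !mxE ord1.
by apply: eq_bigr => k _; rewrite mxE mulr1.
Qed.

Lemma mul_homog_pointP z x t : z *m A = homog_point x t <->
  z *m V = x /\ \sum_i z 0 i = t%:R.
Proof.
rewrite mul_homog /homog_point; split=> [/eq_row_mx[-> /rowP/(_ 0)]|[-> ->]//].
by rewrite !mxE.
Qed.

Definition cone_slice t : set 'rV[R]_n :=
  [set x | @lattice R n x /\
     exists2 z : 'rV[R]_N, (forall i, 0 <= z 0 i) & z *m A = homog_point x t].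

Lemma finite_cone_slice t : finite_set (cone_slice t).
Proof.
apply: sub_finite_set (@finite_lattice_box R n (\sum_j \sum_i t%:R * `|V i j|)).
move=> x [xL [z z0 /mul_homog_pointP[zV zt]]]; split=> // k.
rewrite -zV mxE (le_trans (ler_norm_sum _ _ _))// (bigD1 k)//=.
rewrite (@le_trans _ _ (\sum_i t%:R * `|V i k|))//.
  apply: ler_sum => i _; rewrite normrM ger0_norm// ler_wpM2r//.
  by rewrite -zt (bigD1 i)//= lerDl sumr_ge0.
by rewrite lerDl sumr_ge0// => j _; rewrite sumr_ge0.
Qed.

Context (s : pred 'I_N) (B : {set 'I_N}) (bB : is_basis A B).

Definition cell_coord x t b := (homog_point x t *m coordmx A B) 0 b.

(** The flag [s b] removes the facet where coordinate [b] vanishes. The negation of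
    [lower b (y - 1)] bounds [y] above by one, strictly exactly when [s b] is false. *)
Definition lower (b : 'I_N) (y : R) := (0 <= y) && (s b ==> (0 < y)).

(* For b in S the coordinate is confined to a half-open interval of length one;
   S = B gives the lattice points of the fundamental parallelepiped. *)
Definition cell S t : set 'rV[R]_n :=
  [set x | [/\ @lattice R n x, (homog_point x t <= A)%MS,
     forall b, b \in B -> lower b (cell_coord x t b) &
     forall b, b \in S -> ~~ lower b (cell_coord x t b - 1)]].

Lemma coord_ge0 S t x : cell S t x -> forall i, 0 <= cell_coord x t i.
Proof.
move=> [_ _ xB _] i; have [/xB/andP[]//|iB] := boolP (i \in B).
by rewrite /cell_coord coordmx_supp.
Qed.

Lemma coord_sum t x : (homog_point x t <= A)%MS -> \sum_i cell_coord x t i = t%:R.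
Proof. by move=> xA; rewrite (sum_height homog_height) coordmxK// homog_point_height. Qed.

Lemma cell_cone_slice S t : cell S t `<=` cone_slice t.
Proof.
move=> x xS; have [xL xA _ _] := xS; split=> //.
by exists (homog_point x t *m coordmx A B); [exact: coord_ge0 xS | rewrite coordmxK].
Qed.

Lemma finite_cell S t : finite_set (cell S t).
Proof. exact: sub_finite_set (@cell_cone_slice S t) (finite_cone_slice t). Qed.

Lemma homog_point_shift x t b : homog_point (x + row b V) t.+1 = homog_point x t + row b A.
Proof.
rewrite /homog_point /homog row_row_mx add_row_mx; congr row_mx.
by apply/rowP => i; rewrite !mxE -natr1.
Qed.

Lemma coord_shift x t b i : b \in B ->
  cell_coord (x + row b V) t.+1 i = cell_coord x t i + (i == b)%:R.
Proof.
move=> Bb; rewrite /cell_coord homog_point_shift mulmxDl coord_row// mxE.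
by congr (_ + _); rewrite mxE eqxx.
Qed.

(** A point whose coordinate at [b] stays admissible after subtracting one is the translate by row
    [b] of a point one level lower; the others are those confined at [b]. *)
Lemma cell_peel S t b : b \in B -> b \notin S ->
  cell S t.+1 = cell (b |: S) t.+1 `|` [set x + row b V | x in cell S t].
Proof.
move=> Bb Sb; have nb i : i \in S -> (i == b) = false.
  by move=> iS; apply/eqP => e; rewrite -e iS in Sb.
apply/seteqP; split=> [x [xL xA xB xS]|x].
  have [l|l] := boolP (lower b (cell_coord x t.+1 b - 1)); [right|left]; last first.
    by split=> // i /setU1P[->|/xS].
  have xE : x = x - row b V + row b V by rewrite subrK.
  have cE i : cell_coord x t.+1 i = cell_coord (x - row b V) t i + (i == b)%:R.
    by rewrite {1}xE coord_shift.
  exists (x - row b V); last by rewrite -xE.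
  split.
  - by apply/mxOverP => i j; rewrite !mxE rpredB// (mxOverP xL).
  - have -> : homog_point (x - row b V) t = homog_point x t.+1 - row b A.
      by rewrite {2}xE homog_point_shift addrK.
    by rewrite addmx_sub ?eqmx_opp ?row_sub.
  - move=> i iB; have := xB i iB; rewrite cE.
    have [->|_] := eqVneq i b; last by rewrite addr0.
    by move: l; rewrite cE eqxx addrK.
  - by move=> i iS; have := xS i iS; rewrite cE nb// addr0.
case=> [[xL xA xB xS]|[y [yL yA yB yS] <-]].
  by split=> // i iS; apply: xS; rewrite inE iS orbT.
split.
- by apply/mxOverP => i j; rewrite !mxE rpredD// (mxOverP yL).
- by rewrite homog_point_shift addmx_sub ?row_sub.
- move=> i iB; rewrite coord_shift//; have [_|_] := eqVneq i b; last first.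
    by rewrite addr0 yB.
  by have /andP[i0 _] := yB i iB; rewrite /lower addr_ge0//= ltr_wpDl ?implybT.
- by move=> i iS; rewrite coord_shift// nb// addr0; apply: yS.
Qed.

Lemma cell_peel_disjoint S t b : b \in B ->
  cell (b |: S) t.+1 `&` [set x + row b V | x in cell S t] = set0.
Proof.
move=> Bb; apply/seteqP; split=> x // [[_ _ _ xS] [y [_ _ yB _] yx]].
have := xS b (setU11 _ _); rewrite -yx coord_shift// eqxx addrK => /negP; apply.
exact: yB.
Qed.

(** At level zero the coordinates are nonnegative with sum zero, so the upper bound at [b] holds by
    itself. *)
Lemma cell_peel0 S b : cell (b |: S) 0 = cell S 0.
Proof.
apply/seteqP; split=> x xS; have [xL xA xB xS'] := xS; split=> //.
  by move=> i iS; apply: xS'; rewrite inE iS orbT.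
move=> i /setU1P[->|/xS'//]; rewrite /lower negb_and -ltNge.
have c0 := coord_ge0 xS; have := coord_sum xA.
rewrite (bigD1 b)//= => E.
have : 0 <= \sum_(i0 < N | i0 != b) cell_coord x 0 i0 by apply: sumr_ge0.
by move=> ?; apply/orP; left; lra.
Qed.

Lemma card_cell_peel S b t : b \in B -> b \notin S ->
  card_set (cell S t) = (card_set (cell (b |: S) t) +
    (if t is t'.+1 then card_set (cell S t') else 0))%N.
Proof.
move=> Bb Sb; case: t => [|t]; first by rewrite cell_peel0 addn0.
rewrite (cell_peel _ Bb Sb) card_setU_disjoint ?cell_peel_disjoint//.
- rewrite card_set_image//; first exact: finite_cell.
  by move=> x y _ _; apply: addIr.
- exact: finite_cell.
- exact/finite_image/finite_cell.
Qed.

(** Each factor [1 - z] confines one more coordinate, by [card_cell_peel], leading from the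
    half-open cone to its fundamental parallelepiped. *)
Lemma numerator_cell k : 
  numerator #|B| (fun t => card_set (cell finset.set0 t)) k = card_set (cell B k).
Proof.
suff H m S : S \subset B -> #|B :\: S| = m ->
    numerator m (fun t => card_set (cell S t)) k = card_set (cell B k).
  by apply: H; rewrite ?finset.sub0set ?finset.setD0.
elim: m S => [|m IH] S SB BS.
  rewrite numerator0; suff -> : S = B by [].
  apply/eqP; rewrite finset.eqEsubset SB -finset.setD_eq0.
  by rewrite -cards_eq0 BS.
have [b] : exists b, b \in B :\: S by apply/card_gt0P; rewrite BS.
rewrite inE => /andP[Sb Bb]; rewrite (numeratorS _ _ (fun t => card_cell_peel t Bb Sb)).
apply: IH; first by apply/fintype.subsetP => i /setU1P[->//|]; apply: (fintype.subsetP SB).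
have := cardsD1 b (B :\: S); rewrite inE Sb Bb BS => -[->].
by congr #|pred_of_set _|; apply/setP => i; rewrite !inE negb_or andbA.
Qed.

(** Every coordinate in the parallelepiped is at most one, which bounds the level; this makes the
    numerator a polynomial. *)
Lemma cell_empty k : (#|B| < k)%N -> cell B k = set0.
Proof.
move=> Bk; apply/seteqP; split=> x // -[xL xA xB xS].
have := coord_sum xA; rewrite (bigID (mem B))/= [X in _ + X]big1 ?addr0; last first.
  by move=> i iB; rewrite /cell_coord coordmx_supp.
move=> E; suff : k%:R <= #|B|%:R :> R by rewrite ler_nat leqNgt Bk.
rewrite -E -sum1_card natr_sum; apply: ler_sum => i iB.
have := xS i iB; rewrite leNgt; apply: contra => i1.
by rewrite /lower subr_ge0 subr_gt0 i1 implybT (ltW i1).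
Qed.

End Cells.

(** * Nonnegativity of the Ehrhart numerator *)

Section Ehrhart.
Context (R : realType) (N n : nat) (V : 'M[R]_(N, n)).
Context (VL : forall i j, V i j \is a Num.int).

Lemma numerator_cone_slice : exists h : {poly int},
  (forall k, 0 <= h`_k) /\
  (forall k, numerator (\rank (homog V)) (fun t => card_set (cone_slice V t)) k = h`_k).
Proof.
set A := homog V.
have [|mu [mu0 gen_w']] := @generic_vector R N _
  (fun p : {set 'I_N} * 'I_N => is_basis A p.1 && (p.2 \in p.1))
  (fun p => col p.2 (A *m coordmx A p.1)).
  (* The column is nonzero, because row [b] has coordinate one at [b] in the basis [B]. *)
  move=> [B b] /= /andP[bB Bb]; apply/eqP => /matrixP/(_ b 0) E.
  have /rowP/(_ b) := coord_row bB Bb.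
  rewrite [LHS]mxE [RHS]mxE in E; rewrite -row_mul [LHS]mxE E mxE !eqxx.
  by move/esym/eqP; rewrite oner_eq0.
have [|c' [_ gen_c']] := @generic_vector R N _
  (fun p : {set 'I_N} * 'I_N => is_basis A p.1 && (p.2 \notin p.1))
  (fun p => (row p.2 (A *m coordmx A p.1) - delta_mx 0 p.2)^T).
  (* Entry [b] of this vector is [-1], since coordinates in [B] vanish outside [B]. *)
  move=> [B b] /= /andP[bB Bb]; apply/eqP => /matrixP/(_ b 0).
  rewrite !mxE eqxx/= big1 => [|i _]; last by rewrite coordmx_out ?mulr0.
  by move/eqP; rewrite eqxx sub0r oppr_eq0 oner_eq0.
pose c := c'^T; pose w := mu *m A.
have gen_w B b : is_basis A B -> b \in B -> (mu *m A *m coordmx A B) 0 b != 0.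
  move=> bB Bb; have := gen_w' (B, b); rewrite /= bB Bb => /(_ isT).
  have -> // : (mu *m col b (A *m coordmx A B)) 0 0 = (mu *m A *m coordmx A B) 0 b.
  rewrite -(mulmxA mu A) mxE [RHS]mxE; apply: eq_bigr => i _.
  by rewrite [col _ _ _ _]mxE.
have gen_c B i : is_basis A B -> i \notin B -> (A *m coordmx A B *m c) i 0 != c i 0.
  move=> bB iB; have := gen_c' (B, i); rewrite /= bB iB => /(_ isT).
  apply: contra => /eqP E; rewrite -[c']trmxK -trmx_mul mxE mulmxBl -row_mul.
  by rewrite -rowE -/c -linearB mxE mxE [X in _ + X]mxE E subrr.
(* The facets removed from the cone over [B] are those separating it from [w]; with this choice
   [halfopen] is the condition in [cell] with no coordinate confined. *)
pose s B b := (w *m coordmx A B) 0 b < 0.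
pose T := enum (optimal A c).
have TP B : B \in T = optimal A c B by rewrite mem_enum.
have bas B : B \in T -> is_basis A B by rewrite TP => /andP[].
pose F B t := card_set (cell V (s B) B B t).
have sliceE t : cone_slice V t =
    [set x | exists2 B, B \in T & cell V (s B) B finset.set0 t x].
  apply/seteqP; split=> x.
    move=> [xL [z z0 zA]].
    have [B oB hB] := halfopen_exists (homog_height V) mu0 gen_w gen_c z0.
    rewrite -/A zA in hB; exists B; first by rewrite TP.
    split=> //; first by rewrite -zA submxMl.
      exact/forall_inP.
    by move=> b; rewrite inE.
  move=> [B TB xB].
  exact: (cell_cone_slice (bas _ TB) xB).
(* The coefficients count the points at level [k] in all parallelepipeds; there are none beyond the
   rank, the common size of all bases. *)
exists (\poly_(k < (\rank A).+1) (\sum_(B <- T) F B k)%N%:Z).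
split=> k; rewrite coef_poly; first by case: ifP.
transitivity ((\sum_(B <- T) F B k)%N%:Z).
  rewrite (@eq_numerator _ _ (fun t => (\sum_(B <- T) card_set (cell V (s B) B finset.set0 t))%N)).
    rewrite numerator_sum (big_morph Posz PoszD erefl) !big_seq.
    apply: eq_bigr => B TB; rewrite -(basis_card (bas _ TB)).
    exact: numerator_cell (bas _ TB) _.
  move=> t; rewrite sliceE card_set_partition//.
  - exact: enum_uniq.
  - by move=> B TB; apply: finite_cell (bas _ TB) _ _.
  move=> B B' x TB TB' [xL xA xB _] [_ _ xB' _].
  rewrite !TP in TB TB'.
  have hB : halfopen A mu B (homog_point x t) by exact/forall_inP.
  have hB' : halfopen A mu B' (homog_point x t) by exact/forall_inP.
  exact: (halfopen_unique gen_w xA TB TB' hB hB').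
case: ltnP => // rk; rewrite big_seq big1// => B TB.
by rewrite /F cell_empty ?card_set0// ?(basis_card (bas _ TB))// bas.
Qed.

End Ehrhart.

(** * Stationary distributions of stochastic matrices *)

Section Stationary.
Context (R : realFieldType) (N : nat).

(* The entrywise absolute value of a left eigenvector for the eigenvalue 1 is
   again one, because the triangle inequalities add up to an equality. *)
Lemma stationary (L : 'M[R]_N) : (0 < N)%N ->
  (forall i j, 0 <= L i j) -> (forall i, \sum_j L i j = 1) ->
  exists p : 'rV[R]_N, [/\ forall i, 0 <= p 0 i, \sum_i p 0 i = 1 & p *m L = p].
Proof.
move=> N0 L0 L1; pose i0 := Ordinal N0.
(* [L] fixes the all-ones column, so [1] is an eigenvalue and has a left eigenvector as well. *)
have : \det (1%:M - L) == 0.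
  rewrite -det_tr; apply/det0P; exists (const_mx 1).
    by apply/eqP => /rowP/(_ i0)/eqP; rewrite !mxE oner_eq0.
  apply/rowP => i; rewrite !mxE.
  under eq_bigr => j _ do rewrite !mxE mul1r.
  rewrite sumrB L1 (bigD1 i)//= eqxx big1 ?addr0 ?subrr// => j /negPf ji.
  by rewrite eq_sym ji.
case/det0P => v v0; rewrite mulmxBr mulmx1 => /eqP; rewrite subr_eq0 => /eqP vL.
pose q : 'rV[R]_N := \row_j `|v 0 j|.
have q0 j : 0 <= q 0 j by rewrite mxE.
have qle j : 0 <= (q *m L - q) 0 j.
  rewrite mxE [X in _ + X]mxE [X in _ - X]mxE subr_ge0 vL mxE.
  rewrite (le_trans (ler_norm_sum _ _ _))// mxE ler_sum// => k _.
  by rewrite normrM mxE (ger0_norm (L0 _ _)).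
(* The entries of [q *m L - q] are nonnegative and, as the rows of [L] sum to one, add up to
   zero. *)
have qL : q *m L = q.
  apply/eqP; rewrite -subr_eq0; apply/eqP/rowP => j; rewrite [RHS]mxE.
  apply: (psumr_eq0P (P := xpredT) (F := fun j => (q *m L - q) 0 j)) => //.
  under eq_bigr => k _ do rewrite mxE [X in _ + X]mxE mxE.
  rewrite sumrB exchange_big/=; apply/eqP; rewrite subr_eq0; apply/eqP.
  by apply: eq_bigr => k _; rewrite -mulr_sumr L1 mulr1.
pose s := \sum_j q 0 j.
have s0 : 0 < s.
  rewrite lt_neqAle sumr_ge0// andbT eq_sym; apply: contra v0 => /eqP s0.
  apply/eqP/rowP => j; rewrite [RHS]mxE; apply: normr0_eq0.
  have : q 0 j = 0 by apply: (psumr_eq0P (P := xpredT) (F := fun j => q 0 j)).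
  by rewrite mxE.
exists (s^-1 *: q); split.
- by move=> i; rewrite mxE mulr_ge0// invr_ge0 ltW.
- under eq_bigr => j _ do rewrite mxE.
  by rewrite -mulr_sumr mulVf// gt_eqF.
- by rewrite -scalemxAl qL.
Qed.

End Stationary.

(** * Polytopes as sets of convex combinations: dilates and dimension *)

Section Hull.
Context (R : realType) (N n : nat) (V : 'M[R]_(N, n)) (N0 : (0 < N)%N).
Implicit Types (x a b : 'rV[R]_n) (z : 'rV[R]_N).

Definition simplex (t : R) : set 'rV[R]_N :=
  [set z | (forall i, 0 <= z 0 i) /\ \sum_i z 0 i = t].

Definition combos : set 'rV[R]_n := [set z *m V | z in simplex 1].

Lemma delta_simplex i : simplex 1 (delta_mx 0 i).
Proof.
split=> [j|]; first by rewrite mxE ler0n.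
rewrite (bigD1 i)//= big1 ?addr0 ?mxE ?eqxx// => j ji.
by rewrite mxE (negPf ji).
Qed.

Lemma combos_row i : combos (row i V).
Proof. by exists (delta_mx 0 i); rewrite -?rowE//; exact: delta_simplex. Qed.

Lemma combos_convex : convex_set (combos : set (convex_lmodType 'rV[R]_n)).
Proof.
move=> x y l; rewrite !inE => -[z [z0 z1] <-] [z' [z'0 z'1] <-].
exists (l%:num *: z + (1 - l%:num) *: z'); last first.
  by rewrite mulmxDl -!scalemxAl.
split=> [i|].
  by rewrite !mxE addr_ge0// mulr_ge0// subr_ge0 le1.
under eq_bigr => i _ do rewrite !mxE.
by rewrite big_split -!mulr_sumr/= z1 z'1; ring.
Qed.

(** Convexity handles two points at a time, so the sum is built row by row, each partial sum being
    its total weight times a point of [C]. *)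
Lemma combos_sub_convex (C : set 'rV[R]_n) :
  convex_set (C : set (convex_lmodType 'rV[R]_n)) ->
  (forall i, C (row i V)) -> combos `<=` C.
Proof.
move=> cC rC x [z [z0 z1] <-].
suff [p Cp E] : exists2 p, C p &
    \sum_i z 0 i *: row i V = (\sum_i z 0 i) *: p.
  by rewrite mulmx_sum_row E z1 scale1r.
elim: (index_enum _) => [|i r [p Cp IH]].
  by exists (row (Ordinal N0) V) => //; rewrite !big_nil scale0r.
rewrite !big_cons IH; set S := \sum_(j <- r) _.
have S0 : 0 <= S by apply: sumr_ge0.
have [T0|T0] := eqVneq (z 0 i + S) 0.
  exists p => //; have zi := z0 i.
  have -> : z 0 i = 0 by lra.
  by rewrite scale0r add0r add0r.
have Tp : 0 < z 0 i + S by rewrite lt_neqAle eq_sym T0 addr_ge0.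
have l0 : 0 <= z 0 i / (z 0 i + S) by rewrite divr_ge0// ltW.
have l1 : z 0 i / (z 0 i + S) <= 1 by rewrite ler_pdivrMr// mul1r lerDl.
exists ((z 0 i / (z 0 i + S)) *: row i V + (1 - z 0 i / (z 0 i + S)) *: p).
  by have := cC (row i V) p (Itv01 l0 l1); rewrite !inE; apply.
rewrite scalerDr !scalerA mulrBr mulr1 !(mulrC (z 0 i + S)) divfK//.
by congr (_ + _ *: _); ring.
Qed.

Lemma convex_hull_rows : convex_hull [set row i V | i in [set: 'I_N]] = combos.
Proof.
apply/seteqP; split.
  apply: smallest_sub; first exact: combos_convex.
  by move=> x [i _ <-]; exact: combos_row.
apply: combos_sub_convex => [x y l xC yC|i]; last first.
  by apply: sub_gen_smallest; exists i.
rewrite !inE in xC yC *; move=> C CP; have [cC _] := CP.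
by have := cC x y l; rewrite !inE; apply; [exact: xC|exact: yC].
Qed.

Lemma dilate_combos (t : nat) b x : dilate t b combos x <->
  exists2 z, simplex t%:R z & x = z *m V + b.
Proof.
split=> [[y [z [z0 z1] <-] <-]|[z [z0 zt] ->]].
  exists (t%:R *: z); last by rewrite scalemxAl.
  split=> [i|]; first by rewrite mxE mulr_ge0.
  under eq_bigr => i _ do rewrite mxE.
  by rewrite -mulr_sumr z1 mulr1.
(* For [t = 0] rescaling is impossible; all weights vanish, and any row of [V] serves as the point
   to be scaled by zero. *)
have [t0|t0] := eqVneq t 0%N.
  exists (row (Ordinal N0) V); first exact: combos_row.
  have -> : z = 0.
    apply/rowP => i; rewrite [RHS]mxE.
    apply: (psumr_eq0P (P := xpredT) (F := fun i => z 0 i)) => //.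
    by rewrite zt t0.
  by rewrite t0 scale0r mul0mx.
have tR : t%:R != 0 :> R by rewrite pnatr_eq0.
exists ((t%:R^-1 *: z) *m V); last by rewrite -scalemxAl scalerA mulfV// scale1r.
exists (t%:R^-1 *: z) => //; split=> [i|].
  by rewrite mxE mulr_ge0// invr_ge0.
under eq_bigr => i _ do rewrite mxE.
by rewrite -mulr_sumr zt mulVf.
Qed.

Lemma ehrhart_cone_slice t : ehrhart combos t = card_set (cone_slice V t).
Proof.
congr card_set; apply/seteqP; split=> x.
  move=> [/dilate_combos[z [z0 zt] ->] xL]; rewrite addr0 in xL *.
  by split=> //; exists z => //; apply/mul_homog_pointP.
move=> [xL [z z0 /mul_homog_pointP[zV zt]]]; split=> //.
by apply/dilate_combos; exists z => //; rewrite zV addr0.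
Qed.

(* Cancellation of i P from both sides: if the vertex v_k satisfies
   i v_k + a = t (L V)_k + b with L stochastic, average over a stationary
   distribution of L. *)
Lemma dilate_cancel (i t : nat) a b : dilate i a combos `<=` dilate t b combos ->
  exists2 p, combos p & a = b + (t%:R - i%:R) *: p.
Proof.
move=> sub.
have /choice[L LP] k : exists z, simplex 1 z /\
    i%:R *: row k V + a = t%:R *: (z *m V) + b.
  have /sub[x [z zS <-] <-] : dilate i a combos (i%:R *: row k V + a).
    by exists (row k V) => //; exact: combos_row.
  by exists z.
pose M := \matrix_k L k.
have rM k : row k M = L k by rewrite rowK.
have [||p [p0 p1 pM]] := stationary (L := M) N0.
- by move=> k j; rewrite mxE; have [[]] := LP k.
- by move=> k; rewrite -(proj2 (proj1 (LP k))); apply: eq_bigr => j _; rewrite mxE.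
exists (p *m V); first by exists p.
(* All vertex equations as one matrix identity; multiplying by [p] on the left turns [M *m V] into
   [p *m V]. *)
have E : i%:R *: V + const_mx 1 *m a = t%:R *: (M *m V) + (const_mx 1 : 'cV_N) *m b.
  apply/row_matrixP => k.
  have one c : row k ((const_mx 1 : 'cV_N) *m c) = c :> 'rV[R]_n.
    by apply/rowP => j; rewrite !mxE big_ord1 mxE mul1r.
  by rewrite !linearD !linearZ/= !one row_mul rM; have [_] := LP k.
have ones c : p *m ((const_mx 1 : 'cV_N) *m c) = c :> 'rV[R]_n.
  rewrite mulmxA; have -> : p *m (const_mx 1 : 'cV_N) = 1%:M.
    apply/matrixP => j k; rewrite !ord1 [RHS]mxE eqxx -[RHS]p1 mxE.
    by apply: eq_bigr => l _; rewrite mxE mulr1.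
  by rewrite mul1mx.
have := congr1 (mulmx p) E; rewrite !mulmxDr !ones -!scalemxAr mulmxA pM.
by move=> E'; rewrite scalerBl addrA (addrC b) -E' addrC addKr.
Qed.

(** Forward, [dilate_cancel] removes [i P] from both sides; conversely, weights of totals [i] and
    [t - i] add up to weights of total [t]. *)
Lemma dilate_sub (i t : nat) a : (i <= t)%N ->
  dilate i a combos `<=` dilate t 0 combos <-> dilate (t - i) 0 combos a.
Proof.
move=> it; split=> [/dilate_cancel[p pC ->]|/dilate_combos[z [z0 zt] ->]].
  by exists p => //; rewrite natrB// addr0 add0r.
move=> x /dilate_combos[z' [z'0 z't] ->]; apply/dilate_combos.
exists (z' + z); last by rewrite mulmxDl !addr0.
split=> [k|]; first by rewrite mxE addr_ge0.
under eq_bigr => k _ do rewrite mxE.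
by rewrite big_split/= zt z't natrB// addrC subrK.
Qed.

(** The extent of the polytope along coordinate [k] is positive, and dilating by [i] multiplies it
    by [i]. *)
Lemma dilate_scale_le (i t : nat) a b i0 j0 k : V i0 k != V j0 k ->
  dilate i a combos `<=` dilate t b combos -> (i <= t)%N.
Proof.
move=> Vij sub.
have [u _ uP] := arg_maxP (fun l => V l k) (i0 := i0) (P := xpredT) isT.
have [v _ vP] := arg_minP (fun l => V l k) (i0 := i0) (P := xpredT) isT.
have uv : V v k < V u k.
  have [ij|ij|E] := ltgtP (V i0 k) (V j0 k); last by rewrite E eqxx in Vij.
    exact: le_lt_trans (vP i0 isT) (lt_le_trans ij (uP j0 isT)).
  exact: le_lt_trans (vP j0 isT) (lt_le_trans ij (uP i0 isT)).
have h l : exists2 y, V v k <= y <= V u k & i%:R * V l k + a 0 k = t%:R * y + b 0 k.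
  have /sub[x [z [z0 z1] <-] E] : dilate i a combos (i%:R *: row l V + a).
    by exists (row l V) => //; exact: combos_row.
  exists ((z *m V) 0 k).
    rewrite mxE -[V v k]mul1r -[V u k]mul1r -z1 !mulr_suml.
    apply/andP; split; apply: ler_sum => m _; apply: ler_wpM2l => //.
      exact: vP.
    exact: uP.
  by have /rowP/(_ k) := E; rewrite !mxE => <-.
have [y /andP[_ yu] Eu] := h u; have [y' /andP[y'v _] Ev] := h v.
rewrite -(ler_nat R); have t0 : 0 <= t%:R :> R by [].
have : i%:R * (V u k - V v k) <= t%:R * (V u k - V v k).
  have : t%:R * y <= t%:R * V u k by rewrite ler_wpM2l.
  have : t%:R * V v k <= t%:R * y' by rewrite ler_wpM2l.
  lra.
by rewrite ler_pM2r// subr_gt0.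
Qed.

(** Lets positive dimension exclude polytopes reduced to a point, whose dilates do not determine
    their scale. *)
Lemma rank_homog_const : (forall i j k, V i k = V j k) -> (\rank (homog V) <= 1)%N.
Proof.
move=> Vc; have -> : homog V = (const_mx 1 : 'cV_N) *m row (Ordinal N0) (homog V).
  apply/row_matrixP => i; rewrite row_mul.
  have -> : row i (const_mx 1 : 'cV[R]_N) = 1%:M.
    by apply/matrixP => j k; rewrite !ord1 !mxE.
  rewrite mul1mx /homog !row_row_mx; congr row_mx; apply/rowP => k.
    by rewrite !mxE; apply: Vc.
  by rewrite !mxE.
by rewrite (leq_trans (mxrankM_maxl _ _))// rank_leq_col.
Qed.

(** The points [x] with [(x, 1)] in the row space form a translate of the space of all [u] with
    [(u, 0)] in it. This affine subspace contains the affine hull, which gives one inclusion in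
    [rank_homog]. *)
Lemma sub_affine_homog : exists2 D, (exists k, affine_subspace k D) &
  combos `<=` D /\ forall x, D x -> (row_mx x (const_mx 1 : 'rV_1) <= homog V)%MS.
Proof.
set A := homog V; pose one : 'rV[R]_1 := const_mx 1.
exists [set x | (row_mx x one <= A)%MS]; last first.
  split=> // x [z [z0 z1] <-] /=; have := submxMl z A.
  by rewrite mul_homog z1.
pose x0 := row (Ordinal N0) V.
have x0A : (row_mx x0 one <= A)%MS.
  have := row_sub (Ordinal N0) A; rewrite row_row_mx.
  by congr (row_mx _ _ <= _)%MS; apply/rowP => k; rewrite !mxE.
pose C := row_mx (1%:M : 'M[R]_n) (0 : 'M_(n, 1)) *m cokermx A.
pose W := lker (linfun (mulmxr C : 'rV[R]_n -> 'rV_(n + 1))).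
have WP u : (u \in W) = (row_mx u (0 : 'rV_1) <= A)%MS.
  by rewrite memv_ker lfunE/= submxE /C mulmxA mul_mx_row mulmx1 mulmx0.
exists (\dim W), x0, W; split=> //; apply/seteqP; split=> x /=.
  move=> xA; exists (x - x0); last by rewrite addrC subrK.
  rewrite /= WP; have -> : row_mx (x - x0) 0 = row_mx x one - row_mx x0 one.
    by rewrite opp_row_mx add_row_mx subrr.
  by rewrite addmx_sub ?eqmx_opp.
move=> [u /= uW <-]; rewrite WP in uW.
have -> : row_mx (x0 + u) one = row_mx x0 one + row_mx u 0.
  by rewrite add_row_mx addr0.
exact: addmx_sub.
Qed.

(** If the affine hull is [a + U], the row space of [homog V] is spanned by [(a, 1)] and the
    independent vectors [(u, 0)] with [u] in a basis of [U]. *)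
Lemma rank_homog d : has_dim combos d -> \rank (homog V) = d.+1.
Proof.
move=> [a [U [<- hullE]]]; set A := homog V.
pose one : 'rV[R]_1 := const_mx 1.
pose M : 'M[R]_(\dim U, n) := \matrix_i (vbasis U)`_i.
pose G := col_mx (row_mx a one) (row_mx M 0).
have rG : \rank G = (\dim U).+1.
  suff /eqP : row_free G by [].
  apply: inj_row_free => v.
  rewrite -[v]hsubmxK mul_row_col !mul_mx_row mulmx0 add_row_mx addr0.
  rewrite -[0]row_mx0 => /eq_row_mx[vM v1].
  have l0 : lsubmx v = 0.
    apply/matrixP => i j; have /matrixP/(_ i 0) := v1.
    by rewrite !mxE big_ord1 !mxE mulr1 !ord1.
  rewrite l0 mul0mx add0r in vM *.
  suff -> : rsubmx v = 0 by rewrite row_mx0.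
  apply/rowP => i; rewrite [RHS]mxE.
  have /freeP fU := basis_free (vbasisP U).
  apply: (fU (fun i => rsubmx v 0 i)); rewrite -[RHS]vM mulmx_sum_row.
  by apply: eq_bigr => j _; rewrite rowK.
have AG : (A <= G)%MS.
  apply/row_subP => i.
  have : affine_hull combos (row i V).
    by apply: sub_gen_smallest; exact: combos_row.
  rewrite hullE => -[u /= uU uE].
  pose k : 'rV[R]_(\dim U) := \row_j coord (vbasis U) j u.
  have kM : k *m M = u.
    rewrite mulmx_sum_row [RHS](coord_vbasis uU).
    by apply: eq_bigr => j _; rewrite rowK mxE.
  have -> : row i A = row_mx 1%:M k *m G.
    rewrite mul_row_col mul1mx mul_mx_row mulmx0 kM add_row_mx addr0 uE row_row_mx.
    by congr row_mx; apply/rowP => j; rewrite !mxE.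
  exact: submxMl.
have GA : (G <= A)%MS.
  have [D affD [CD DA]] := sub_affine_homog.
  have hA u : u \in U -> (row_mx (a + u) one <= A)%MS.
    move=> uU; have : affine_hull combos (a + u) by rewrite hullE; exists u.
    by move/(@smallest_sub _ (fun E => exists k, affine_subspace k E) _ _ affD CD)/DA.
  have aA : (row_mx a one <= A)%MS by rewrite -[a]addr0 hA ?mem0v.
  rewrite col_mx_sub aA; apply/row_subP => i; rewrite row_row_mx rowK.
  have -> : row_mx (vbasis U)`_i (row i 0) = row_mx (a + (vbasis U)`_i) one - row_mx a one.
    rewrite opp_row_mx add_row_mx subrr addrAC subrr add0r.
    by congr row_mx; apply/rowP => j; rewrite !mxE.
  rewrite addmx_sub ?eqmx_opp// hA// vbasis_mem// mem_nth//.
  by rewrite size_tuple.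
by apply/eqP; rewrite -rG eqn_leq !mxrankS.
Qed.

End Hull.

(** * Counting gigantures *)

Section Gigantures.
Context (R : realType) (N n : nat) (V : 'M[R]_(N, n)) (N0 : (0 < N)%N).
Local Notation P := (combos V).

Definition scaled_gigantures t : set (nat * 'rV[R]_n) :=
  [set ia : nat * 'rV[R]_n |
    [/\ lattice ia.2, (ia.1 <= t)%N & dilate ia.1 ia.2 P `<=` dilate t 0 P]].

Lemma scaled_giganturesE t : scaled_gigantures t =
  [set ia | exists2 i, i \in iota 0 t.+1 &
     [set (i, a) | a in dilate (t - i) 0 P `&` @lattice R n] ia].
Proof.
apply/seteqP; split=> -[i a].
  move=> [aL it iaP]; exists i; first by rewrite mem_iota.
  by exists a => //; split=> //; apply/dilate_sub.
move=> [j]; rewrite mem_iota add0n ltnS /= => jt [b [bD bL] [<- <-]]; split=> //.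
exact/dilate_sub.
Qed.

Lemma finite_dilate_lattice t : finite_set (dilate t 0 P `&` @lattice R n).
Proof.
apply: sub_finite_set (finite_cone_slice V t) => x.
move=> [/(dilate_combos V N0)[z [z0 zt] ->] xL]; rewrite addr0 in xL *.
by split=> //; exists z => //; apply/mul_homog_pointP.
Qed.

Lemma finite_scaled_gigantures t : finite_set (scaled_gigantures t).
Proof.
rewrite scaled_giganturesE.
rewrite [X in finite_set X](_ : _ = \bigcup_(i in [set` iota 0 t.+1])
    [set (i, a) | a in dilate (t - i) 0 P `&` @lattice R n]); last first.
  by apply/seteqP; split=> x [i] /=; exists i.
apply: bigcup_finite; first exact: finite_seq.
by move=> i _; apply/finite_image/finite_dilate_lattice.
Qed.

Lemma scaled_giganture_countE t :
  scaled_giganture_count P t = (\sum_(0 <= i < t.+1) ehrhart P (t - i))%N.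
Proof.
rewrite /scaled_giganture_count -/(scaled_gigantures t) scaled_giganturesE.
rewrite card_set_partition ?iota_uniq//.
- rewrite /index_iota subn0; apply: eq_bigr => i _.
  rewrite card_set_image//; first exact: finite_dilate_lattice.
  by move=> x y _ _ [].
- by move=> i _; apply/finite_image/finite_dilate_lattice.
by move=> i j x _ _ [a _ <-] [b _ []].
Qed.

(** Scale zero contributes [ehrhart P t], and positive scales at [t] correspond to all scales at
    [t - 1]; for the series this is division by [1 - z]. *)
Lemma scaled_giganture_countS t : scaled_giganture_count P t =
  (ehrhart P t + (if t is t'.+1 then scaled_giganture_count P t' else 0))%N.
Proof.
rewrite scaled_giganture_countE big_nat_recl// subn0; congr (_ + _)%N.
by case: t => [|t]; [rewrite big_geq | rewrite scaled_giganture_countE].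
Qed.

(** When [P] is not a point, [(i, a)] can be recovered from [i P + a]: comparing extents gives [i],
    and cancellation gives [a]. *)
Lemma giganture_countE t i0 j0 k : V i0 k != V j0 k ->
  giganture_count P t = scaled_giganture_count P t.
Proof.
move=> Vij; rewrite /scaled_giganture_count -/(scaled_gigantures t).
rewrite -(card_set_image (f := fun ia => dilate ia.1 ia.2 P)).
- congr card_set; apply/seteqP; split=> G.
    move=> [[i [a [aL ->]]] sub]; exists (i, a) => //; split=> //=.
    exact: dilate_scale_le Vij sub.
  by move=> [[i a] [/= aL it sub] <-]; split=> //; exists i, a.
- exact: finite_scaled_gigantures.
move=> [i a] [j b] _ _ /= E.
have ij : i = j.
  apply/eqP; rewrite eqn_leq.
  rewrite (dilate_scale_le Vij (a := a) (b := b)) ?E//.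
  by rewrite (dilate_scale_le Vij (a := b) (b := a)) ?E.
rewrite ij in E *; congr pair.
have [|p _] := @dilate_cancel _ _ _ V N0 j j a b; first by rewrite E.
by rewrite subrr scale0r addr0.
Qed.

End Gigantures.

(** * Passage to a vertex matrix and conclusion *)

Lemma lattice_polytope_combos (R : realType) n (P : set 'rV[R]_n) :
  lattice_polytope P -> exists N (V : 'M[R]_(N, n)),
    [/\ (0 < N)%N, forall i j, V i j \is a Num.int & P = combos V].
Proof.
move=> [W [/finite_seqP[s ->] [x0 sx0] sL ->]].
have s0 : (0 < size s)%N by case: s sx0 {sL}.
pose V := \matrix_(i < size s) s`_i.
exists (size s), V; split=> //.
  move=> i j; rewrite mxE; have /sL/mxOverP : [set` s] s`_i by rewrite /= mem_nth.
  exact.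
rewrite -convex_hull_rows//; congr convex_hull; apply/seteqP; split=> x /=.
  move=> /(nthP 0)[i si <-]; exists (Ordinal si) => //; by rewrite rowK.
by move=> [i _ <-]; rewrite rowK mem_nth.
Qed.

Theorem theorem5 (R : realType) (n d : nat) (P : set 'rV[R]_n)
    (hdn : (d <= n)%N) (hP : lattice_polytope P) (hd : has_dim P d) :
  exists h : {poly int},
    [/\ forall k : nat, 0 <= h`_k,
        forall k : nat, hstar d P k = h`_k,
        (0 < d)%N -> forall k : nat, hsharp d P k = h`_k
      & forall k : nat, scaled_hsharp d P k = h`_k].
Proof.
have [N [V [N0 VL PE]]] := lattice_polytope_combos hP.
rewrite PE in hd *; have rV := rank_homog N0 hd.
have [h [h0 hE]] := numerator_cone_slice VL.
have hstarE k : hstar d (combos V) k = h`_k.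
  by rewrite -hE rV; apply: eq_numerator => t; rewrite ehrhart_cone_slice.
have scaledE k : scaled_hsharp d (combos V) k = h`_k.
  by rewrite -hstarE; apply: numeratorS => t; apply: scaled_giganture_countS.
exists h; split=> // d0 k; rewrite -scaledE; apply: eq_numerator => t.
(* If all rows of [V] were equal, [homog V] would have rank at most one, against rank [d.+1] with
   [d] positive. *)
have [[i [j [l Vij]]]|Vc] :=
    pselect (exists i j l, V i l != V j l); first exact: giganture_countE Vij.
have := @rank_homog_const R N n V N0; rewrite rV ltnS leqNgt d0 => /(_ _)/negP[]//.
by move=> i j l; apply: contra_notP Vc => /eqP Vij; exists i, j, l.
Qed.
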